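(* Let $p$ be a positive integer, let $\boldsymbol{\beta}=(\beta_0,\ldots,\beta_{p-1})$ be an alternate base of length $p$, and let $\delta=\prod_{i=0}^{p-1}\beta_i$. If $\delta$ is a Pisot number and $\beta_i\in\mathbb{Q}(\delta)$ for all $i\in\{0,\ldots,p-1\}$, then $d_{\boldsymbol{\beta}^{(i)}}(1)$ is eventually periodic for all $i\in\{0,\ldots,p-1\}$.
   Context: An alternate base of length $p$ is a $p$-tuple $\boldsymbol\beta=(\beta_0,\ldots,\beta_{p-1})$ of real numbers greater than $1$. For all $n\in\mathbb Z$, $\beta_n=\beta_{n\bmod p}$ and $\boldsymbol\beta^{(n)}=(\beta_n,\ldots,\beta_{n+p-1})$. For $x\in[0,1]$, the $\boldsymbol\beta$-expansion $d_{\boldsymbol\beta}(x)=\varepsilon_0(x)\varepsilon_1(x)\varepsilon_2(x)\cdots$ is the infinite sequence of digits given by the greedy algorithm: $\varepsilon_0(x)=\lfloor\beta_0x\rfloor$, $r_0(x)=\beta_0x-\varepsilon_0(x)$, and for $n\ge1$, $\varepsilon_n(x)=\lfloor\beta_nr_{n-1}(x)\rfloor$, $r_n(x)=\beta_nr_{n-1}(x)-\varepsilon_n(x)$. The expansion $d_{\boldsymbol\beta^{(i)}}(1)$ is obtained by applying this to the alternate base $\boldsymbol\beta^{(i)}$ and $x=1$. An infinite word is eventually periodic if it is of the form $uv^\omega=uvvv\cdots$ with $u,v$ finite words and $v$ non-empty. A Pisot number is an algebraic integer $\beta>1$ whose Galois conjugates (other than $\beta$ itself) all have modulus less than $1$;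 in particular every integer greater than $1$ is a Pisot number. *)

(* Defs.v *)
From mathcomp Require Import all_boot all_order all_algebra.
From mathcomp Require Import reals.
From mathcomp.real_closed Require Import complex.

Set Implicit Arguments.
Unset Strict Implicit.
Unset Printing Implicit Defensive.

Import Order.TTheory GRing.Theory Num.Theory.
Local Open Scope ring_scope.

Section AlternateBases.
Variables (R : realType) (p : nat).

Definition alternate_base (beta : p.-tuple R) : Prop :=
  (0 < p)%N /\ forall i : 'I_p, 1 < tnth beta i.

(** For [0 < p], the remainder [(n %% p)%Z] lies in [0, p), so the default
    value of the sequence access is never returned. *)
Definition base_at (beta : p.-tuple R) (n : int) : R :=
  beta`_(`|(n %% p%:Z)%Z|%N).

Definition base_shift (beta : p.-tuple R) (n : int) : p.-tuple R :=
  [tuple base_at beta (n + (j : nat)%:Z) | j < p].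

(** The index is off by one: [greedy_rem beta x n] is r_(n-1)(x), with the
    convention r_(-1)(x) = x, which merges the two cases of the algorithm. *)
Fixpoint greedy_rem (beta : p.-tuple R) (x : R) (n : nat) : R :=
  if n is m.+1 then
    let y := base_at beta m%:Z * greedy_rem beta x m in
    y - (Num.floor y)%:~R
  else x.

Definition expansion (beta : p.-tuple R) (x : R) (n : nat) : int :=
  Num.floor (base_at beta n%:Z * greedy_rem beta x n).

End AlternateBases.

(** The prefix [u] may be empty; only [v] must not be. *)
Definition eventually_periodic (w : nat -> int) : Prop :=
  exists u v : seq int, v != [::] /\
    forall n : nat,
      w n = if (n < size u)%N then u`_n else v`_((n - size u) %% size v)%N.

Section PisotNumbers.
Variable R : realType.

Definition algebraic_integer (x : R) : Prop := integralOver (intr : int -> R) x.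

Definition min_poly_over_rat (q : {poly rat}) (x : R) : Prop :=
  [/\ q \is monic, irreducible_poly q & root (map_poly ratr q) x].

Definition galois_conjugate (x : R) (z : R[i]) : Prop :=
  exists2 q : {poly rat}, min_poly_over_rat q x & root (map_poly ratr q) z.

(** The order on [R[i]] is partial; since a modulus is a nonnegative real,
    [`|z| < 1] is the usual comparison. *)
Definition pisot (x : R) : Prop :=
  [/\ 1 < x, algebraic_integer x &
      forall z : R[i], galois_conjugate x z -> z != (x%:C)%C -> `|z| < 1].

(** [y \in Q(x)], the smallest subfield of [R] containing [x] (every subfield
    of [R] contains the rationals).  As [0^-1 = 0], [divring_closed] subsets of
    [R] are exactly its subfields; classically, boolean predicates cover all
    subsets. *)
Definition in_rat_adjoin (x y : R) : Prop :=
  forall K : {pred R}, GRing.divring_closed K -> x \in K -> y \in K.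

End PisotNumbers.

(* Main.v *)
Require Import Defs.
From mathcomp Require Import all_boot all_order all_algebra.
From mathcomp Require Import separable.
From mathcomp Require Import boolp reals.
From mathcomp.real_closed Require Import complex.

(** Let [b] be the shifted base, read as a [p]-periodic sequence; the product
    [x] of one period is unchanged by the shift.  Since the greedy remainder
    [r_(n+1)] depends only on [r_n] and on [b_n], it is enough to find two
    blocks [a < c] with [r_(ap) = r_(cp)]: from then on the digits repeat with
    period [(c - a)p].

    Over a whole block the greedy algorithm reads
    [r_((k+1)p) = x * r_(kp) - D_k], where [D_k] combines the digits of the
    block with products of bases ([greedy_block]).  These products lie in
    [Q(x)], hence are values at [x] of rational polynomials
    ([rat_adjoin_poly]); after multiplication by a common denominator [N],
    [N * r_(kp)] is the value at [x] of an integer polynomial [S_k], and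
    [S_(k+1)] is ['X * S_k - D_k] reduced modulo the minimal polynomial [q] of
    [x], which is monic with integer coefficients by Gauss's lemma
    ([min_poly_integral]).

    Every root of [q] sees the sequence [S_k] as bounded: at [x] itself
    because the remainders lie between 0 and 1, and at any other conjugate [z]
    because [|z| < 1] makes the recurrence a contraction up to a bounded
    term.  This is where the Pisot hypothesis enters.  As [q] has [deg q]
    distinct roots and [S_k] has degree less than [deg q], inverting a
    Vandermonde matrix turns these bounds into bounds on the integer
    coefficients of [S_k] ([bounded_int_poly_repeat]).  Only finitely many
    polynomials are left, so [S_a = S_c] for some [a < c]
    ([pisot_recurrence_repeat]), and evaluating at [x] gives
    [r_(ap) = r_(cp)]. *)

Set Implicit Arguments.
Unset Strict Implicit.
Unset Printing Implicit Defensive.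

Import Order.TTheory GRing.Theory Num.Theory.
Local Open Scope ring_scope.

(** * Minimal polynomials over the rationals *)

Lemma map_poly_ratr_int (F : numFieldType) (P : {poly int}) :
  map_poly ratr (map_poly (intr : int -> rat) P) = map_poly intr P :> {poly F}.
Proof.
by rewrite -map_poly_comp; apply: eq_map_poly => c /=; rewrite ratr_int.
Qed.

(** Descend to a polynomial of least size vanishing at [x]: a proper factor
    would give a smaller one, so its monic multiple is irreducible. *)
Lemma exists_min_poly (R : realType) (x : R) (P : {poly rat}) :
  P != 0 -> root (map_poly ratr P) x -> exists q, min_poly_over_rat q x.
Proof.
have [n le_Pn] := ubnP (size P); elim: n => // n IHn in P le_Pn *.
move=> nzP rootP.
have [[A [nzA rootA ltAP]]|minP] :=
  EM (exists A, [/\ A != 0, root (map_poly ratr A) x & (size A < size P)%N]).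
  exact: (IHn A (leq_trans ltAP le_Pn)).
have ge_size A : A != 0 -> root (map_poly ratr A) x -> (size P <= size A)%N.
  move=> nzA rootA; rewrite leqNgt; apply/negP => ltAP.
  by apply: minP; exists A.
have nzl : lead_coef P != 0 by rewrite lead_coef_eq0.
exists ((lead_coef P)^-1 *: P); split.
- by apply/monicP; rewrite lead_coefZ mulVf.
- have eqPP : (lead_coef P)^-1 *: P %= P by rewrite eqp_scale ?invr_eq0.
  split.
    rewrite (eqp_size eqPP) ltn_neqAle eq_sym lt0n size_poly_eq0 nzP andbT.
    apply: contraTN rootP => /size_poly1P[c nzc ->].
    by rewrite map_polyC rootC fmorph_eq0.
  move=> A sA /[1!(eqp_dvdr A eqPP)] dvAP.
  rewrite (eqp_rtrans eqPP).
  have /dvdpP[B defP] := dvAP.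
  have := nzP; rewrite defP mulf_eq0 => /norP[nzB nzA].
  move: rootP; rewrite defP rmorphM rootM => /orP[] rt.
    have := ge_size _ nzB rt; rewrite defP size_mul //.
    move: nzA nzB sA; rewrite -!size_poly_eq0.
    case: (size A) => [|[|a]] //; case: (size B) => // b _ _ _.
    by rewrite addnS /= addnS ltnNge leq_addr.
  rewrite -defP -dvdp_size_eqp // eqn_leq ge_size // andbT.
  by rewrite dvdp_leq.
- by rewrite linearZ /= rootZ // fmorph_eq0 invr_eq0.
Qed.

(** In characteristic 0 the derivative is nonzero and of smaller size, so an
    irreducible polynomial cannot divide it. *)
Lemma irreducible_separable (F : numFieldType) (q : {poly F}) :
  irreducible_poly q -> separable_poly q.
Proof.
move=> irr_q; have [gt1 _] := irr_q; rewrite unlock irreducible_poly_coprime //.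
have nzq' : q^`() != 0.
  apply/eqP => /polyP/(_ (size q).-2)/eqP; rewrite coef_deriv coef0 mulrn_eq0.
  have -> : (size q).-2.+1 = (size q).-1 by case: (size q) gt1 => [|[]].
  by rewrite lead_coef_eq0 -size_poly_eq0; case: (size q) gt1 => [|[]].
apply/negP => /(dvdp_leq nzq'); rewrite leqNgt.
by rewrite (lt_size_deriv (irredp_neq0 irr_q)).
Qed.

Lemma min_poly_dvdp (R : realType) (x : R) (q A : {poly rat}) :
  min_poly_over_rat q x -> (q %| A) = root (map_poly ratr A) x.
Proof.
case=> _ irr_q rq; apply/idP/idP => [/dvdpP[B ->]|rA].
  by rewrite rmorphM rootM rq orbT.
apply: contraLR rA; rewrite -irreducible_poly_coprime //.
rewrite -(coprimep_map (ratr : rat -> R)) => /coprimep_root; exact.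
Qed.

(** Gauss's lemma: a monic rational factor of the monic integer polynomial [P]
    is a multiple of an integer factor [q1] of [P], whose leading coefficient
    divides 1. *)
Lemma min_poly_integral (R : realType) (x : R) : algebraic_integer x ->
  exists2 q : {poly int}, q \is monic & min_poly_over_rat (map_poly intr q) x.
Proof.
case=> P monP rootP.
have [q min_q] : exists q, min_poly_over_rat q x.
  apply: (@exists_min_poly _ _ (map_poly intr P)).
    exact/monic_neq0/monic_map.
  by rewrite map_poly_ratr_int.
have dv_qP : q %| map_poly intr P.
  by rewrite (min_poly_dvdp _ min_q) map_poly_ratr_int.
have [q1 [a nza defq] [r defP]] := dvdpP_rat_int dv_qP.
have := monicP monP; rewrite defP lead_coefM => lead1.
have unit_l : lead_coef q1 \is a GRing.unit.
  by apply/unitrPr; exists (lead_coef r).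
have sgn_l : lead_coef q1 * lead_coef q1 = 1.
  by move: unit_l => /orP[] /eqP->.
(* The leading coefficient is 1 or -1, hence its own inverse. *)
exists (lead_coef q1 *: q1).
  by apply/monicP; rewrite lead_coefZ.
have mon_q : q \is monic by case: min_q.
suff -> : map_poly intr (lead_coef q1 *: q1) = q by [].
rewrite linearZ /=; have := monicP mon_q.
rewrite defq lead_coefZ lead_coef_map_inj //; last exact: intr_inj.
move/(congr1 ( *%R^~ (lead_coef q1)%:~R)).
by rewrite -mulrA -intrM sgn_l mulr1 mul1r => ->.
Qed.

(** For algebraic [x] the polynomial expressions in [x] already form a field:
    a Bezout relation [u * q + v * g = 1] evaluated at [x] shows that [v.[x]]
    is the inverse of [g.[x]]. *)
Lemma rat_adjoin_poly (R : realType) (x y : R) (q : {poly rat}) :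
  min_poly_over_rat q x -> in_rat_adjoin x y ->
  exists f : {poly rat}, y = (map_poly ratr f).[x].
Proof.
pose K := [pred z | `[< exists f : {poly rat}, z = (map_poly ratr f).[x] >]].
move=> min_q /(_ K) Kxy; apply/asboolP; apply: Kxy; last first.
  by apply/asboolP; exists 'X; rewrite map_polyX hornerX.
split=> [|_ _ /asboolP[f ->] /asboolP[g ->]|_ _ /asboolP[f ->] /asboolP[g ->]].
- by apply/asboolP; exists 1; rewrite rmorph1 hornerC.
- by apply/asboolP; exists (f - g); rewrite rmorphB hornerD hornerN.
apply/asboolP.
have [dv_qg|] := boolP (q %| g).
  exists 0; rewrite (min_poly_dvdp _ min_q) in dv_qg.
  by rewrite (rootP dv_qg) invr0 mulr0 rmorph0 horner0.
have [_ irr_q rq] := min_q.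
rewrite -irreducible_poly_coprime // => /Bezout_eq1_coprimepP[[u v] /= uv1].
exists (f * v); rewrite rmorphM hornerM; congr (_ * _).
have /(congr1 (fun h => (map_poly (ratr : rat -> R) h).[x])) := uv1.
rewrite rmorphD !rmorphM hornerD !hornerM (rootP rq) mulr0 add0r.
rewrite rmorph1 hornerC => vg1.
have nz_gx : (map_poly ratr g).[x] != 0.
  by apply/eqP => g0; move/eqP: vg1; rewrite g0 mulr0 eq_sym oner_eq0.
by rewrite -[LHS]mul1r -vg1 -mulrA divff ?mulr1.
Qed.

Lemma common_denominator (I : finType) (h : I -> {poly rat}) :
  exists2 N : int, N != 0 &
    forall j, exists H : {poly int}, map_poly intr H = N%:~R *: h j.
Proof.
have /choice[D /all_and2[D0 defD]] : forall j, exists D : {poly int} * int,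
    D.2 != 0 /\ map_poly intr D.1 = D.2%:~R *: h j.
  move=> j; have [H [a nza ->]] := rat_poly_scale (h j).
  by exists (H, a); split=> //=; rewrite scalerA divff ?scale1r ?intr_eq0.
exists (\prod_j (D j).2) => [|j]; first exact/prodf_neq0.
exists ((\prod_(i | i != j) (D i).2) *: (D j).1).
by rewrite linearZ /= defD scalerA -intrM mulrC [in RHS](bigD1 j).
Qed.

(** * Integer polynomials bounded at many points *)

Lemma pigeonhole_rV (d B : nat) (r : nat -> 'rV[int]_d) :
  (forall k j, `|r k 0 j| <= B%:Z) -> exists a b, (a < b)%N /\ r a = r b.
Proof.
move=> leB.
(* Entries lie in [- B, B]; adding B moves them to [0, 2B]. *)
pose F k : {ffun 'I_d -> 'I_(B.*2.+1)} :=
  [ffun j => inord (absz (r k 0 j + B%:Z))].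
have injF a b : F a = F b -> r a = r b.
  move=> eqF; apply/rowP => j; have /ffunP/(_ j) := eqF; rewrite !ffunE.
  move/(congr1 val); rewrite /=.
  have ge0 k : 0 <= r k 0 j + B%:Z.
    by rewrite -lerBlDr sub0r; have := leB k j; rewrite ler_norml => /andP[].
  have ltB k : (absz (r k 0 j + B%:Z)%R < B.*2.+1)%N.
    rewrite ltnS -lez_nat gez0_abs // -addnn PoszD lerD2r.
    by have := leB k j; rewrite ler_norml => /andP[].
  rewrite !inordK // => /(congr1 Posz); rewrite !gez0_abs //.
  exact: addIr.
have [|noinj] := EM (exists a b, (a < b)%N /\ r a = r b) => //.
have injr : injective (fun k : 'I_#|{: {ffun 'I_d -> 'I_(B.*2.+1)}}|.+1 => F k).
  move=> a b /injF eq_r; apply: val_inj => /=.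
  by case: (ltngtP a b) => // lt; case: noinj; [exists a, b | exists b, a].
by have := leq_card _ injr; rewrite card_ord ltnn.
Qed.

(** The coefficients of [S] are obtained from its values at [d] distinct points
    by the inverse of a Vandermonde matrix, which does not depend on [S]. *)
Lemma bounded_values_bounded_coefs (C : numFieldType) (d : nat)
    (g : 'I_d -> C) (B : C) :
  injective g -> exists B' : C, forall S : {poly C}, (size S <= d)%N ->
    (forall i, `|S.[g i]| <= B) -> forall j : 'I_d, `|S`_j| <= B'.
Proof.
move=> inj_g; pose V := Vandermonde d (\row_j g j).
have unitV : V \in unitmx.
  rewrite unitmxE det_Vandermonde unitfE; apply/prodf_neq0 => i _.
  apply/prodf_neq0 => j ltij; rewrite !mxE subr_eq0.
  by apply: contraTneq ltij => /inj_g ->; rewrite ltnn.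
exists (\sum_i \sum_j B * `|invmx V i j|) => S leSd leB j.
have -> : S`_j = ((\row_i S.[g i]) *m invmx V) 0 j.
  have -> : \row_i S.[g i] = poly_rV S *m V.
    apply/rowP => i; rewrite !mxE (horner_coef_wide _ leSd).
    by apply: eq_bigr => k _; rewrite !mxE.
  by rewrite mulmxK // mxE.
have B0 : 0 <= B by apply: le_trans (leB j).
rewrite mxE (le_trans (ler_norm_sum _ _ _)) //; apply: ler_sum => i _.
rewrite (bigD1 j) //= normrM mxE ler_wpDr ?ler_wpM2r //.
by apply: sumr_ge0 => k _; rewrite mulr_ge0.
Qed.

Lemma bounded_int_poly_repeat (R : realType) (d : nat) (g : 'I_d -> R[i])
    (B : R[i]) (S : nat -> {poly int}) :
  injective g -> (forall k, (size (S k) <= d)%N) ->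
    (forall k i, `|(map_poly intr (S k)).[g i]| <= B) ->
  exists a b, (a < b)%N /\ S a = S b.
Proof.
move=> inj_g leSd leB; have [B' leB'] := bounded_values_bounded_coefs B inj_g.
have leSB k (j : 'I_d) : `|(S k)`_j| <= (Num.bound (complex.Re B'))%:Z.

  have := leB' _ (leq_trans (size_poly _ _) (leSd k)) (leB k) j.
  rewrite coef_map /= normrMz normr1 => leB'j.
  have B'ge0 : 0 <= B' by apply: le_trans leB'j; rewrite ler0z.
  have defB' := RRe_real (ger0_real B'ge0).
  have ReB'ge0 : 0 <= complex.Re B' by rewrite -lecR defB'.
  have {}leB'j : (`|(S k)`_j|)%:~R <= complex.Re B'.
    by rewrite -lecR defB' rmorph_int.
  by rewrite -(ler_int R) (le_trans leB'j) // ltW // archi_boundP.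
have leSrV k (j : 'I_d) :
    `|poly_rV (S k) 0 j| <= (Num.bound (complex.Re B'))%:Z by rewrite mxE.
have [a [b [ltab eqab]]] := pigeonhole_rV leSrV.
exists a, b; split=> //.
by rewrite -(poly_rV_K (leSd a)) eqab poly_rV_K.
Qed.

(** * Recurrences driven by a Pisot number *)

Lemma normc_real (R : rcfType) (y : R) : `|y%:C%C| = `|y|%:C%C.
Proof. by rewrite normc_def /= expr0n addr0 sqrtr_sqr. Qed.

Lemma horner_map_intr (A B : nzRingType) (f : {rmorphism A -> B})
    (S : {poly int}) (x : A) :
  (map_poly intr S).[f x] = f (map_poly intr S).[x].
Proof.
rewrite -horner_map -map_poly_comp; congr (_.[_]).
by apply: eq_map_poly => c /=; rewrite rmorph_int.
Qed.

(** Working over the integers, rather than over a field, is possible because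
    the divisor [q] is monic. *)
Lemma horner_map_rmodp (A : comNzRingType) (q T : {poly int}) (z : A) :
  q \is monic -> (map_poly intr q).[z] = 0 ->
  (map_poly intr (Pdiv.CommonRing.rmodp T q)).[z] = (map_poly intr T).[z].
Proof.
move=> mon_q qz0; rewrite [in RHS](Pdiv.RingMonic.rdivp_eq mon_q T).
by rewrite rmorphD rmorphM hornerD hornerM qz0 mulr0 add0r.
Qed.

Lemma conjugates_enum (R : realType) (x : R) (q : {poly rat}) :
  min_poly_over_rat q x ->
  exists d (g : 'I_d -> R[i]),
    [/\ size q = d.+1, injective g & forall i, root (map_poly ratr q) (g i)].
Proof.
case=> mon_q irr_q _.
have [r def_q] := closed_field_poly_normal (map_poly (ratr : rat -> R[i]) q).
rewrite lead_coef_map (monicP mon_q) rmorph1 scale1r in def_q.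
have uniq_r : uniq r.
  by rewrite -separable_prod_XsubC -def_q separable_map irreducible_separable.
exists (size r), (tnth (in_tuple r)); split.
- rewrite -(size_map_poly (ratr : {rmorphism rat -> R[i]})) def_q.
  by rewrite size_prod_XsubC.
- move=> i j; rewrite !(tnth_nth 0) /= => /eqP.
  by rewrite nth_uniq // => /eqP /val_inj.
by move=> i; rewrite def_q root_prod_XsubC mem_tnth.
Qed.

(** Lift [s] to integer polynomials [S k] reduced modulo the minimal polynomial
    of [x].  The lift obeys the same recurrence at every conjugate of [x]: at
    [x] it is bounded by the assumption on [s], at the others by contraction. *)
Lemma pisot_recurrence_repeat (R : realType) (x : R) (N : int) (M : R)
    (D : nat -> {poly int}) (s : nat -> R) :
  pisot x ->
  (forall z : R[i], exists B, forall k, `|(map_poly intr (D k)).[z]| <= B) ->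
  s 0 = N%:~R -> (forall k, s k.+1 = x * s k - (map_poly intr (D k)).[x]) ->
  (forall k, `|s k| <= M) ->
  exists a b, (a < b)%N /\ s a = s b.
Proof.
move=> [gt1x int_x conj_x] boundD s0 sS leM.
have [q mon_q min_q] := min_poly_integral int_x.
have [d [g [size_q inj_g root_g]]] := conjugates_enum min_q.
rewrite size_map_inj_poly ?rmorph0 // in size_q; last exact: intr_inj.
have d_gt0 : (0 < d)%N.
  have [_ [+ _] _] := min_q.
  by rewrite size_map_inj_poly ?rmorph0 ?size_q //; exact: intr_inj.
have qg0 i : (map_poly intr q).[g i] = 0.
  by have := rootP (root_g i); rewrite map_poly_ratr_int.
have qx0 : (map_poly intr q).[x] = 0.
  by have [_ _ /rootP] := min_q; rewrite map_poly_ratr_int.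
(* B i bounds N, and the recurrence at the i-th conjugate preserves it. *)
have /choice[B leB] : forall i, exists B, forall S k, `|N%:~R| <= B /\
    ((map_poly intr S).[x] = s k -> `|(map_poly intr S).[g i]| <= B ->
     `|g i * (map_poly intr S).[g i] - (map_poly intr (D k)).[g i]| <= B).
  move=> i; have [E leE] := boundD (g i).
  have E0 : 0 <= E by apply: le_trans (leE 0).
  have [->|neq] := eqVneq (g i) x%:C%C.
    exists M%:C%C => S k; split=> [|Sx _].
      by rewrite -(rmorph_int (real_complex R)) -s0 normc_real lecR.
    rewrite !horner_map_intr /= Sx -rmorphM -rmorphB -sS.
    by rewrite normc_real lecR.
  have lt1 : `|g i| < 1.
    by apply: conj_x neq; exists (map_poly intr q).
  have gt0 : 0 < 1 - `|g i| by rewrite subr_gt0.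
  (* E / (1 - |g i|) is the fixed point of t |-> |g i| * t + E, so the interval
     below it is stable; adding |N| makes room for the initial value. *)
  pose c := E / (1 - `|g i|).
  have c_fix : `|g i| * c + E = c.
    have : (1 - `|g i|) * c = E by rewrite mulrC divfK ?gt_eqF.
    by rewrite mulrBl mul1r => <-; rewrite addrC subrK.
  exists (`|N%:~R| + c) => S k; split=> [|_ leS].
    by rewrite lerDl divr_ge0 // ltW.
  apply: le_trans (ler_normB _ _) _; rewrite normrM.
  apply: le_trans (lerD (ler_wpM2l (normr_ge0 _) leS) (leE k)) _.
  by rewrite mulrDr -addrA c_fix lerD2r ler_piMl // ltW.
have /choice[S /all_and3[leSd Sx leSB]] : forall k, exists S : {poly int},
    [/\ (size S <= d)%N, (map_poly intr S).[x] = s k &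
        forall i, `|(map_poly intr S).[g i]| <= B i].
  elim=> [|k [S [leSd Sx leSB]]].
    exists N%:P; split=> [||i]; first exact: leq_trans (size_polyC_leq1 _) _.
      by rewrite map_polyC hornerC.
    by rewrite map_polyC hornerC; have [] := leB i 0 0.
  pose T := 'X * S - D k.
  have evalT (A : comNzRingType) (z : A) :
      (map_poly intr T).[z] =
        z * (map_poly intr S).[z] - (map_poly intr (D k)).[z].
    by rewrite rmorphB rmorphM hornerD hornerN hornerM /= map_polyX hornerX.
  exists (Pdiv.CommonRing.rmodp T q); split=> [||i].
  - by rewrite -ltnS -size_q Pdiv.CommonRing.ltn_rmodpN0 ?monic_neq0.
  - by rewrite horner_map_rmodp // evalT Sx -sS.
  by rewrite horner_map_rmodp // evalT; have [_] := leB i S k; apply.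
have leSsum k i : `|(map_poly intr (S k)).[g i]| <= \sum_i `|B i|.
  apply: le_trans (leSB k i) _.
  have Bge0 j : 0 <= B j by apply: le_trans (leSB k j).
  by rewrite (bigD1 i) //= ger0_norm // lerDl sumr_ge0.
have [a [b [ltab eqS]]] := bounded_int_poly_repeat inj_g leSd leSsum.
by exists a, b; rewrite -!Sx eqS.
Qed.

(** * The greedy algorithm *)

Lemma greedy_block (R : comNzRingType) (b r e : nat -> R) :
  (forall n, r n.+1 = b n * r n - e n) -> forall m n,
  r (m + n)%N = (\prod_(0 <= l < n) b (m + l)%N) * r m
    - \sum_(j < n) e (m + j)%N * \prod_(j.+1 <= l < n) b (m + l)%N.
Proof.
move=> rS m; elim=> [|n IHn].
  by rewrite addn0 big_nil big_ord0 mul1r subr0.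
rewrite addnS rS IHn big_nat_recr //= big_ord_recr /=.
rewrite [\prod_(n.+1 <= _ < n.+1) _]big_geq // mulr1.
rewrite mulrBr opprD addrA mulrA [b _ * _]mulrC; congr (_ - _ - _).
rewrite mulr_sumr; apply: eq_bigr => j _.
by rewrite big_nat_recr //= mulrCA [b _ * _]mulrC.
Qed.

Lemma periodic_add (T : Type) (p : nat) (b : nat -> T) :
  (forall n, b (n + p)%N = b n) -> forall k n, b (k * p + n)%N = b n.
Proof.
move=> per; elim=> // k IHk n; by rewrite mulSn -addnA addnC per.
Qed.


Lemma eventually_periodic_repeat (w : nat -> int) (a c : nat) :
  (0 < c)%N -> (forall n, w (a + n)%N = w (a + (n + c))%N) ->
  eventually_periodic w.
Proof.
move=> c_gt0 per; exists (mkseq w a), (mkseq (fun n => w (a + n)%N) c).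
split=> [|n]; first by rewrite -size_eq0 size_mkseq -lt0n.
rewrite !size_mkseq; case: ltnP => [ltna|lean]; first by rewrite nth_mkseq.
rewrite nth_mkseq ?ltn_mod // -[in LHS](subnKC lean).
rewrite [in LHS](divn_eq (n - a) c).
elim: (_ %/ c)%N => [|k IHk]; first by rewrite mul0n.
by rewrite mulSn -addnA [in LHS](addnC c) -per.
Qed.

Lemma greedy_rem_itv (R : realType) (b r : nat -> R) (e : nat -> int) :
  r 0 = 1 -> (forall n, e n = Num.floor (b n * r n)) ->
  (forall n, r n.+1 = b n * r n - (e n)%:~R) -> forall n, 0 <= r n <= 1.
Proof.
move=> r0 eE rS [|n]; first by rewrite r0 ler01 lexx.
have /andP[lo /ltW hi] := floor_itv (b n * r n).
by rewrite rS eE subr_ge0 lo lerBlDl -[1]/(1%:~R) -intrD.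
Qed.

(** Sampling the remainders once per period gives a recurrence with the constant
    multiplier [x], to which [pisot_recurrence_repeat] applies.  Sampling also
    matters because a single [b n] need be neither an algebraic integer nor
    small at the conjugates of [x]. *)
Lemma greedy_eventually_periodic (R : realType) (p : nat) (b r : nat -> R)
    (e : nat -> int) :
  (0 < p)%N -> (forall n, b (n + p)%N = b n) -> (forall n, 0 <= b n) ->
  pisot (\prod_(0 <= l < p) b l) ->
  (forall n, in_rat_adjoin (\prod_(0 <= l < p) b l) (b n)) ->
  r 0 = 1 -> (forall n, e n = Num.floor (b n * r n)) ->
  (forall n, r n.+1 = b n * r n - (e n)%:~R) ->
  eventually_periodic e.
Proof.
move=> p_gt0 per b_ge0; set x := \prod_(0 <= l < p) b l.
move=> pisot_x adj_b r0 eE rS.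
have per_mul := periodic_add per.
have r_itv := greedy_rem_itv r0 eE rS.
have [q _ min_q] := min_poly_integral (let: And3 _ int_x _ := pisot_x in int_x).
have /choice[f fE] n := rat_adjoin_poly min_q (adj_b n).
have [N nzN /choice[H HE]] :=
  common_denominator (fun j : 'I_p => \prod_(j.+1 <= l < p) f l).
have Hx j : (map_poly intr (H j)).[x] = N%:~R * \prod_(j.+1 <= l < p) b l.
  have := congr1 (fun P => (map_poly (ratr : rat -> R) P).[x]) (HE j).
  rewrite linearZ /= hornerZ ratr_int rmorph_prod horner_prod.
  rewrite map_poly_ratr_int.
  by move=> ->; congr (_ * _); apply: eq_bigr => l _; rewrite -fE.
have [||||a [c [ltac eq_s]]] := @pisot_recurrence_repeat R x N `|N%:~R|
  (fun k => \sum_(j < p) e (k * p + j)%N *: H j)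
  (fun k => N%:~R * r (k * p)%N) pisot_x.
(* Each digit e (k * p + j) lies in [0, b j], whatever the block k. *)
- move=> z.
  exists (\sum_(j < p) (b j)%:C%C * `|(map_poly intr (H j)).[z]|) => k.
  rewrite rmorph_sum horner_sum; apply: le_trans (ler_norm_sum _ _ _) _.
  apply: ler_sum => j _; rewrite /= linearZ /= hornerZ normrM ler_wpM2r //.
  rewrite -(rmorph_int (real_complex R)) normc_real lecR.
  have /andP[r_ge0 r_le1] := r_itv (k * p + j)%N.
  have e_ge0 : 0 <= e (k * p + j)%N by rewrite eE floor_ge0 mulr_ge0.
  rewrite ger0_norm ?ler0z // eE (le_trans (floor_le _)) //.
  by rewrite per_mul ler_piMr.
- by rewrite mul0n r0 mulr1.
- move=> k; rewrite mulSn addnC (greedy_block rS) mulrBr; congr (_ - _).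
    by rewrite mulrCA; congr (_ * _); apply: eq_bigr => l _; rewrite per_mul.
  rewrite rmorph_sum horner_sum mulr_sumr; apply: eq_bigr => j _.
  rewrite /= linearZ /= hornerZ Hx mulrCA; congr (_ * (_ * _)).
  by apply: eq_bigr => l _; rewrite per_mul.
- move=> k; have /andP[r_ge0 r_le1] := r_itv (k * p)%N.
  by rewrite normrM (ger0_norm r_ge0) ler_piMr.
have eq_r : r (a * p)%N = r (c * p)%N.
  by apply: mulfI eq_s; rewrite intr_eq0.
have eq_rn n : r (a * p + n)%N = r (c * p + n)%N.
  by elim: n => [|n IHn]; rewrite ?addn0 // !addnS !rS !eE !per_mul IHn.
apply: (@eventually_periodic_repeat _ (a * p) ((c - a) * p)) => [|n].
  by rewrite muln_gt0 subn_gt0 ltac.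
rewrite addnCA -mulnDl subnKC 1?ltnW // [in RHS]addnC.
by rewrite !eE !per_mul eq_rn.
Qed.

Lemma prod_period (R : comNzRingType) (p : nat) (b : nat -> R) :
  (forall n, b (n + p)%N = b n) -> forall i,
  \prod_(0 <= l < p) b (i + l)%N = \prod_(0 <= l < p) b l.
Proof.
move=> per; elim=> // i <-.
case: p per => [|p] per; first by rewrite !big_nil.
rewrite big_nat_recr // [RHS]big_nat_recl //= addn0 mulrC; congr (_ * _).
  by rewrite addSnnS per.
by apply: eq_bigr => l _; rewrite addSnnS.
Qed.

Theorem theorem25 (R : realType) (p : nat) (beta : p.-tuple R)
    (hbeta : alternate_base beta)
    (hpisot : pisot (\prod_(i < p) tnth beta i))
    (hfield : forall i : 'I_p,
       in_rat_adjoin (\prod_(j < p) tnth beta j) (tnth beta i)) :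
  forall i : 'I_p,
    eventually_periodic (expansion (base_shift beta (i : nat)%:Z) 1).
Proof.
move=> i; have [p_gt0 gt1] := hbeta.
pose c n := beta`_(n %% p)%N.
have per_c n : c (n + p)%N = c n by rewrite /c modnDr.
have cE n : c n = tnth beta (Ordinal (ltn_pmod n p_gt0)).
  by rewrite (tnth_nth 0).
have prod_c : \prod_(0 <= l < p) c (i + l)%N = \prod_(j < p) tnth beta j.
  rewrite prod_period // big_mkord; apply: eq_bigr => j _.
  by rewrite cE; congr tnth; apply: val_inj; rewrite /= modn_small.
have base_atE (t : p.-tuple R) n : base_at t n%:Z = t`_(n %% p)%N.
  by rewrite /base_at modz_nat.
have shiftE n : base_at (base_shift beta (i : nat)%:Z) n%:Z = c (i + n)%N.
  rewrite base_atE -[(_ %% p)%N]/(val (Ordinal (ltn_pmod n p_gt0))) -tnth_nth.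
  by rewrite tnth_mktuple -PoszD base_atE /= /c modnDmr.
apply: (@greedy_eventually_periodic _ p (fun n => c (i + n)%N)
    (greedy_rem (base_shift beta (i : nat)%:Z) 1)) => //.
- by move=> n; rewrite addnA per_c.
- by move=> n; rewrite cE ltW // (lt_trans ltr01).
- by rewrite prod_c.
- by move=> n; rewrite prod_c cE.
- by move=> n; rewrite /expansion shiftE.
by move=> n; rewrite /expansion -shiftE.
Qed.
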